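(* Let $k\ge 0$ and $\Gamma\in\{\Sigma_k,\Pi_k\}$. The following are equivalent over $\mathsf{HA}$: (1) $\Delta_k^{\mathrm n}\text{-}\mathbf{LEM}$; (2) $(\Delta_k,\Gamma^{\mathrm n})\text{-}\mathbf{DML}$; (3) $(\Delta_k^{\mathrm n},\Gamma)\text{-}\mathbf{DML}$; (4) $(\Delta_k,\Delta_k^{\mathrm n})\text{-}\mathbf{DML}$.
   Context: $\mathsf{HA}$ is first-order intuitionistic (Heyting) arithmetic with connectives $\land,\lor,\to,\exists,\forall,\bot$ ($\neg\varphi$ abbreviates $\varphi\to\bot$), with function symbols for all primitive recursive functions and their defining equations, basic arithmetic axioms, and the full induction scheme. Formulas may contain free variables. Classes: $\Sigma_0=\Pi_0$ is the set of quantifier-free formulas; $\Sigma_{k+1}=\{\exists x_1\cdots\exists x_n\varphi : \varphi\in\Pi_k,\ n\ge1\}$; $\Pi_{k+1}=\{\forall x_1\cdots\forall x_n\varphi : \varphi\in\Sigma_k,\ n\ge 1\}$. $\Gamma^{\mathrm n}=\{\neg\varphi:\varphi\in\Gamma\}$. Principles (with $\varphi,\psi\in\Sigma_k$ and $\varphi',\psi'\in\Pi_k$ wherever $\Delta_k$ or $\Delta_k^{\mathrm n}$ occurs): $\Delta_k^{\mathrm n}\text{-}\mathbf{LEM}$: $(\varphi\leftrightarrow\varphi')\to\neg\varphi\lor\neg\neg\varphi$. $(\Delta_k,\Theta)\text{-}\mathbf{DML}$: $(\varphi\leftrightarrow\varphi')\to(\neg(\varphi\land\chi)\to\neg\varphi\lor\neg\chi)$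 ($\chi\in\Theta$). $(\Delta_k^{\mathrm n},\Theta)\text{-}\mathbf{DML}$: $(\varphi\leftrightarrow\varphi')\to(\neg(\neg\varphi\land\chi)\to\neg\neg\varphi\lor\neg\chi)$ ($\chi\in\Theta$). $(\Delta_k,\Delta_k^{\mathrm n})\text{-}\mathbf{DML}$: $(\varphi\leftrightarrow\varphi')\land(\psi\leftrightarrow\psi')\to(\neg(\varphi\land\neg\psi)\to\neg\varphi\lor\neg\neg\psi)$. For a principle $P$, $\mathsf{HA}+P$ is $\mathsf{HA}$ with the universal closures of all instances of $P$ added as axioms. $P$ and $Q$ are equivalent over $\mathsf{HA}$ if $\mathsf{HA}+P$ proves all instances of $Q$ and $\mathsf{HA}+Q$ proves all instances of $P$. *)

(* Defs.v *)
From Stdlib Require Import List Arith.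
From Stdlib Require Vector Fin.
Import ListNotations.
Set Implicit Arguments.

(** Symbols for primitive recursive functions, by arity. [Rec f g] stands for the [h] with
    [h(0, x) = f(x)] and [h(S y, x) = g(y, h(y, x), x)]. *)
Inductive prim : nat -> Type :=
| Zero : prim 0
| Succ : prim 1
| Proj : forall n, Fin.t n -> prim n
| Comp : forall m n, prim m -> Vector.t (prim n) m -> prim n
| Rec : forall n, prim n -> prim (S (S n)) -> prim (S n).

(** Variables are de Bruijn indices. *)
Inductive term : Type :=
| var : nat -> term
| app : forall n, prim n -> Vector.t term n -> term.

Inductive form : Type :=
| Bot : form
| Eq : term -> term -> form
| And : form -> form -> form
| Or : form -> form -> form
| Imp : form -> form -> form
| Ex : form -> form
| All : form -> form.

Definition zero : term := app Zero (Vector.nil term).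
Definition succ (t : term) : term := app Succ (Vector.cons term t 0 (Vector.nil term)).

Definition Neg (A : form) : form := Imp A Bot.
Definition Iff (A B : form) : form := And (Imp A B) (Imp B A).

Fixpoint subst_term (s : nat -> term) (t : term) : term :=
  match t with
  | var i => s i
  | app f ts => app f (Vector.map (subst_term s) ts)
  end.

Definition shift : nat -> term := fun i => var (S i).

Definition scons (t : term) (s : nat -> term) : nat -> term :=
  fun i => match i with 0 => t | S j => s j end.

Definition up (s : nat -> term) : nat -> term :=
  scons (var 0) (fun i => subst_term shift (s i)).

Fixpoint subst (s : nat -> term) (A : form) : form :=
  match A with
  | Bot => Bot
  | Eq t u => Eq (subst_term s t) (subst_term s u)
  | And B C => And (subst s B) (subst s C)
  | Or B C => Or (subst s B) (subst s C)
  | Imp B C => Imp (subst s B) (subst s C)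
  | Ex B => Ex (subst (up s) B)
  | All B => All (subst (up s) B)
  end.

Definition inst (t : term) (A : form) : form := subst (scons t var) A.
Definition weaken (A : form) : form := subst shift A.

(** Least [n] such that all free variables have index [< n]. *)
Fixpoint term_bound (t : term) : nat :=
  match t with
  | var i => S i
  | app _ ts => Vector.fold_right (fun u b => Nat.max (term_bound u) b) ts 0
  end.

Fixpoint bound (A : form) : nat :=
  match A with
  | Bot => 0
  | Eq t u => Nat.max (term_bound t) (term_bound u)
  | And B C | Or B C | Imp B C => Nat.max (bound B) (bound C)
  | Ex B | All B => Nat.pred (bound B)
  end.

Definition univ_closure (A : form) : form := Nat.iter (bound A) All A.

(** Intuitionistic natural deduction from a set [T] of sentences. The rule [prv_ax] does not
    weaken axioms under binders, which is correct because [T] will only contain sentences. *)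
Inductive prv (T : form -> Prop) : list form -> form -> Prop :=
| prv_ax : forall G A, T A -> prv T G A
| prv_hyp : forall G A, In A G -> prv T G A
| prv_botE : forall G A, prv T G Bot -> prv T G A
| prv_andI : forall G A B, prv T G A -> prv T G B -> prv T G (And A B)
| prv_andE1 : forall G A B, prv T G (And A B) -> prv T G A
| prv_andE2 : forall G A B, prv T G (And A B) -> prv T G B
| prv_orI1 : forall G A B, prv T G A -> prv T G (Or A B)
| prv_orI2 : forall G A B, prv T G B -> prv T G (Or A B)
| prv_orE : forall G A B C,
    prv T G (Or A B) -> prv T (A :: G) C -> prv T (B :: G) C -> prv T G C
| prv_impI : forall G A B, prv T (A :: G) B -> prv T G (Imp A B)
| prv_impE : forall G A B, prv T G (Imp A B) -> prv T G A -> prv T G B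
| prv_exI : forall G A t, prv T G (inst t A) -> prv T G (Ex A)
| prv_exE : forall G A C,
    prv T G (Ex A) -> prv T (A :: map weaken G) (weaken C) -> prv T G C
| prv_allI : forall G A, prv T (map weaken G) A -> prv T G (All A)
| prv_allE : forall G A t, prv T G (All A) -> prv T G (inst t A).

Inductive HA_scheme : form -> Prop :=
| HA_eq_refl : forall t, HA_scheme (Eq t t)
| HA_eq_leibniz : forall A t u,
    HA_scheme (Imp (Eq t u) (Imp (inst t A) (inst u A)))
| HA_succ_neq_zero : forall t, HA_scheme (Neg (Eq (succ t) zero))
| HA_succ_inj : forall t u, HA_scheme (Imp (Eq (succ t) (succ u)) (Eq t u))
| HA_proj : forall n (i : Fin.t n) (ts : Vector.t term n),
    HA_scheme (Eq (app (Proj i) ts) (Vector.nth ts i))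
| HA_comp : forall m n (f : prim m) (gs : Vector.t (prim n) m) (ts : Vector.t term n),
    HA_scheme (Eq (app (Comp f gs) ts) (app f (Vector.map (fun g => app g ts) gs)))
| HA_rec_zero : forall n (f : prim n) (g : prim (S (S n))) (ts : Vector.t term n),
    HA_scheme (Eq (app (Rec f g) (Vector.cons term zero n ts)) (app f ts))
| HA_rec_succ : forall n (f : prim n) (g : prim (S (S n))) (t : term) (ts : Vector.t term n),
    HA_scheme
      (Eq (app (Rec f g) (Vector.cons term (succ t) n ts))
          (app g (Vector.cons term t (S n)
                   (Vector.cons term (app (Rec f g) (Vector.cons term t n ts)) n ts))))
(** In the induction step, [A] lives under the quantified variable [var 0], so the
    substitution [x := S x] replaces [var 0] by [succ (var 0)] and fixes the others. *)
| HA_induction : forall A,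
    HA_scheme
      (Imp (inst zero A)
        (Imp (All (Imp A (subst (scons (succ (var 0)) shift) A))) (All A))).

(** A principle is the set of its instances, which may have free variables. *)
Definition principle := form -> Prop.

Definition closures (P : principle) : form -> Prop :=
  fun B => exists A, P A /\ B = univ_closure A.

Definition HA_plus (P : principle) : form -> Prop :=
  fun B => closures HA_scheme B \/ closures P B.

Definition proves_all (P Q : principle) : Prop :=
  forall A, Q A -> prv (HA_plus P) [] A.

Definition equiv_over_HA (P Q : principle) : Prop :=
  proves_all P Q /\ proves_all Q P.

Fixpoint quantifier_free (A : form) : Prop :=
  match A with
  | Bot | Eq _ _ => True
  | And B C | Or B C | Imp B C => quantifier_free B /\ quantifier_free C
  | Ex _ | All _ => False
  end.

Fixpoint Sigma (k : nat) (A : form) : Prop :=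
  match k with
  | 0 => quantifier_free A
  | S j => exists n B, 1 <= n /\ Pi j B /\ A = Nat.iter n Ex B
  end
with Pi (k : nat) (A : form) : Prop :=
  match k with
  | 0 => quantifier_free A
  | S j => exists n B, 1 <= n /\ Sigma j B /\ A = Nat.iter n All B
  end.

Definition neg_class (C : form -> Prop) : form -> Prop :=
  fun A => exists B, C B /\ A = Neg B.

Definition Delta_n_LEM (k : nat) : principle := fun I =>
  exists A A', Sigma k A /\ Pi k A' /\
    I = Imp (Iff A A') (Or (Neg A) (Neg (Neg A))).

Definition Delta_DML (k : nat) (Theta : form -> Prop) : principle := fun I =>
  exists A A' C, Sigma k A /\ Pi k A' /\ Theta C /\
    I = Imp (Iff A A') (Imp (Neg (And A C)) (Or (Neg A) (Neg C))).

Definition Delta_n_DML (k : nat) (Theta : form -> Prop) : principle := fun I =>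
  exists A A' C, Sigma k A /\ Pi k A' /\ Theta C /\
    I = Imp (Iff A A') (Imp (Neg (And (Neg A) C)) (Or (Neg (Neg A)) (Neg C))).

Definition Delta_Delta_n_DML (k : nat) : principle := fun I =>
  exists A A' B B', Sigma k A /\ Pi k A' /\ Sigma k B /\ Pi k B' /\
    I = Imp (And (Iff A A') (Iff B B'))
          (Imp (Neg (And A (Neg B))) (Or (Neg A) (Neg (Neg B)))).

(* Main.v *)
Require Import Defs.
From Stdlib Require Import List Lia.
From Stdlib Require Vector.
Import ListNotations.

(** All the content is propositional, and everything is routed through the weak excluded
    middle [Or (Neg A) (Neg (Neg A))] for [A] assumed equivalent to [A'], with [A] in
    [Sigma k] and [A'] in [Pi k].

    - Weak excluded middle for [A] yields each De Morgan law, for an arbitrary second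
      conjunct [C]: [Neg (And A C)] with [Neg (Neg A)] gives [Neg C], since [C] would refute
      [A]; and [Neg (And (Neg A) C)] with [Neg A] gives [Neg C].
    - Conversely, each De Morgan law yields weak excluded middle by applying it to the
      conjunction of [A] and its own negation, which is refutable. One of the two occurrences
      of [A] has to lie in [Gamma]; when [Gamma] is [Pi k] it is replaced by [A'], which is
      equivalent to [A] by hypothesis.

    The propositional steps relate instances with the same free variables, whereas the axioms
    are universal closures. The passage from a closure to its open instance
    ([prv_univ_closure_elim]) is the only use of the quantifier rules: every quantifier of
    the closure is instantiated with the variable that it binds. This rests on two facts
    about substitution: it composes, and it depends only on the variables below [bound]. *)

(** * Substitution *)

(** The induction principle generated for [term] gives no hypothesis on the arguments of a
    function symbol. *)
Lemma term_nested_ind (X : term -> Prop) :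
  (forall i, X (var i)) ->
  (forall n (f : prim n) ts, Vector.Forall X ts -> X (Defs.app f ts)) ->
  forall t, X t.
Proof.
  intros hvar happ.
  fix IH 1; intros [i | n f ts].
  - apply hvar.
  - apply happ.
    clear f; induction ts as [| t m ts IHts].
    + constructor.
    + constructor; [apply IH | exact IHts].
Qed.

Lemma subst_term_ext_bound (s r : nat -> term) (t : term) :
  (forall i, i < term_bound t -> s i = r i) -> subst_term s t = subst_term r t.
Proof.
  induction t as [i | n f ts IH] using term_nested_ind; simpl; intros h.
  - apply h; lia.
  - f_equal.
    clear f; induction IH as [| m t ts ht _ IHts]; simpl in *; [reflexivity |].
    f_equal.
    + apply ht; intros i hi; apply h; lia.
    + apply IHts; intros i hi; apply h; lia.
Qed.

Lemma subst_ext_bound (A : form) : forall s r : nat -> term,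
  (forall i, i < bound A -> s i = r i) -> subst s A = subst r A.
Proof.
  assert (hup : forall (s r : nat -> term) b,
    (forall i, i < Nat.pred b -> s i = r i) -> forall i, i < b -> up s i = up r i).
  { intros s r b h [| i] hi; simpl; [reflexivity |].
    rewrite h by lia; reflexivity. }
  induction A; simpl; intros s r h; f_equal;
    try (apply subst_term_ext_bound; intros i hi; apply h; lia);
    eauto;
    match goal with IH : forall s r, _ -> subst s ?A = _ |- subst _ ?A = _ =>
      apply IH; intros i hi; apply h; lia end.
Qed.

Lemma subst_term_comp (s r : nat -> term) (t : term) :
  subst_term s (subst_term r t) = subst_term (fun i => subst_term s (r i)) t.
Proof.
  induction t as [i | n f ts IH] using term_nested_ind; simpl; [reflexivity |].
  f_equal; clear f.
  induction IH as [| m t ts ht _ IHts]; simpl; [reflexivity |].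
  f_equal; assumption.
Qed.

(** The composite is any [q] that agrees pointwise with it, so that the induction passes
    under binders without functional extensionality. *)
Lemma subst_comp (A : form) : forall s r q : nat -> term,
  (forall i, subst_term s (r i) = q i) -> subst s (subst r A) = subst q A.
Proof.
  assert (hterm : forall s r q t, (forall i, subst_term s (r i) = q i) ->
    subst_term s (subst_term r t) = subst_term q t).
  { intros s r q t h; rewrite subst_term_comp.
    apply subst_term_ext_bound; auto. }
  assert (hup : forall s r q, (forall i, subst_term s (r i) = q i) ->
    forall i, subst_term (up s) (up r i) = up q i).
  { intros s r q h [| i]; simpl; [reflexivity |].
    rewrite <- h, !subst_term_comp; reflexivity. }
  induction A; simpl; intros s r q h; f_equal; eauto.
Qed.

Lemma subst_term_var (t : term) : subst_term var t = t.
Proof.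
  induction t as [i | n f ts IH] using term_nested_ind; simpl; [reflexivity |].
  f_equal; clear f.
  induction IH as [| m t ts ht _ IHts]; simpl; [reflexivity |].
  f_equal; assumption.
Qed.

Lemma subst_var (A : form) : subst var A = A.
Proof.
  assert (hup : forall B, subst (up var) B = subst var B).
  { intros B; apply subst_ext_bound; intros [| i] _; reflexivity. }
  induction A; simpl; rewrite ?hup, ?subst_term_var; f_equal; auto.
Qed.

Lemma inst_subst_up (t : term) (s : nat -> term) (A : form) :
  inst t (subst (up s) A) = subst (scons t s) A.
Proof.
  apply subst_comp; intros [| i]; simpl; [reflexivity |].
  rewrite subst_term_comp; apply subst_term_var.
Qed.

(** * Open instances of universal closures *)

(** Since de Bruijn indices count outwards, instantiating the outermost of [n] quantifiers
    with [var (n - 1)], the next with [var (n - 2)], and so on, sends each of the [n] bound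
    variables to the index that it already had. The part of [r] from [n] on is what makes
    the induction go through: the instantiations made so far are pushed to higher indices
    by the later ones. *)
Lemma prv_iter_all_elim T G A n : forall s,
  prv T G (subst s (Nat.iter n All A)) ->
  exists r, (forall i, i < n -> r i = var i) /\ (forall j, r (n + j) = s j) /\
    prv T G (subst r A).
Proof.
  induction n as [| n IH]; intros s h.
  - exists s; repeat split; [lia | exact h].
  - apply (prv_allE (var n)) in h; rewrite inst_subst_up in h.
    destruct (IH _ h) as (r & hlow & hhigh & hr).
    exists r; repeat split; [| | exact hr].
    + intros i hi; destruct (PeanoNat.Nat.eq_dec i n) as [-> | hne].
      * rewrite <- (PeanoNat.Nat.add_0_r n) at 1; apply hhigh.
      * apply hlow; lia.
    + intros j; replace (S n + j) with (n + S j) by lia; apply hhigh.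
Qed.

Lemma prv_univ_closure_elim T G A : prv T G (univ_closure A) -> prv T G A.
Proof.
  unfold univ_closure; intros h.
  rewrite <- (subst_var (Nat.iter _ _ _)) in h.
  destruct (prv_iter_all_elim _ _ _ _ _ h) as (r & hr & _ & h').
  rewrite (subst_ext_bound A r var hr), subst_var in h'; exact h'.
Qed.

Lemma prv_instance (P : principle) G A : P A -> prv (HA_plus P) G A.
Proof.
  intros h; apply prv_univ_closure_elim, prv_ax; right; exists A; auto.
Qed.

(** * The propositional derivations *)

Lemma prv_cut T G A B : prv T G A -> prv T (A :: G) B -> prv T G B.
Proof. intros hA hB; exact (prv_impE (prv_impI hB) hA). Qed.

Ltac hyp := apply prv_hyp; simpl; tauto.

(** Both De Morgan laws are derived for an arbitrary second conjunct and an arbitrary premise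
    [E], so that one derivation serves every class that the conjunct may range over. *)
Lemma prv_DML_of_WLEM T A E C :
  prv T [] (Imp E (Or (Neg A) (Neg (Neg A)))) ->
  prv T [] (Imp E (Imp (Neg (And A C)) (Or (Neg A) (Neg C)))).
Proof.
  intros h; apply (prv_cut _ _ _ _ h); do 2 apply prv_impI.
  apply (@prv_orE _ _ (Neg A) (Neg (Neg A))).
  - apply (@prv_impE _ _ E); hyp.
  - apply prv_orI1; hyp.
  - apply prv_orI2, prv_impI.
    apply (@prv_impE _ _ (Neg A)); [hyp |].
    apply prv_impI, (@prv_impE _ _ (And A C)); [hyp | apply prv_andI; hyp].
Qed.

Lemma prv_neg_DML_of_WLEM T A E C :
  prv T [] (Imp E (Or (Neg A) (Neg (Neg A)))) ->
  prv T [] (Imp E (Imp (Neg (And (Neg A) C)) (Or (Neg (Neg A)) (Neg C)))).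
Proof.
  intros h; apply (prv_cut _ _ _ _ h); do 2 apply prv_impI.
  apply (@prv_orE _ _ (Neg A) (Neg (Neg A))).
  - apply (@prv_impE _ _ E); hyp.
  - apply prv_orI2, prv_impI.
    apply (@prv_impE _ _ (And (Neg A) C)); [hyp | apply prv_andI; hyp].
  - apply prv_orI1; hyp.
Qed.

(** The member of [Gamma] to which a De Morgan law is applied is either of the two
    representatives of the [Delta] formula; the next two lemmas treat them alike. *)
Lemma prv_representative T G A A' B :
  B = A \/ B = A' -> In (Iff A A') G -> In A G -> prv T G B.
Proof.
  intros [-> | ->] hE hA; [apply prv_hyp, hA |].
  apply (prv_impE (prv_andE1 (prv_hyp _ _ _ hE)) (prv_hyp _ _ _ hA)).
Qed.

Lemma prv_of_representative T G A A' B :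
  B = A \/ B = A' -> In (Iff A A') G -> In B G -> prv T G A.
Proof.
  intros [-> | ->] hE hB; [apply prv_hyp, hB |].
  apply (prv_impE (prv_andE2 (prv_hyp _ _ _ hE)) (prv_hyp _ _ _ hB)).
Qed.

Ltac representative hB :=
  first [ hyp
        | eapply prv_representative; [exact hB | simpl; tauto | simpl; tauto]
        | eapply prv_of_representative; [exact hB | simpl; tauto | simpl; tauto] ].

Lemma prv_WLEM_of_DML T A A' B :
  B = A \/ B = A' ->
  prv T [] (Imp (Iff A A') (Imp (Neg (And A (Neg B))) (Or (Neg A) (Neg (Neg B))))) ->
  prv T [] (Imp (Iff A A') (Or (Neg A) (Neg (Neg A)))).
Proof.
  intros hB h; apply (prv_cut _ _ _ _ h), prv_impI.
  apply (@prv_orE _ _ (Neg A) (Neg (Neg B))).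
  - apply (@prv_impE _ _ (Neg (And A (Neg B)))).
    + apply (@prv_impE _ _ (Iff A A')); hyp.
    + apply prv_impI, (@prv_impE _ _ B).
      * apply prv_andE2 with A; hyp.
      * apply (prv_cut _ _ A); [apply prv_andE1 with (Neg B); hyp | representative hB].
  - apply prv_orI1; hyp.
  - apply prv_orI2, prv_impI, (@prv_impE _ _ (Neg B)); [hyp |].
    apply prv_impI, (@prv_impE _ _ A); [hyp | representative hB].
Qed.

Lemma prv_WLEM_of_neg_DML T A A' B :
  B = A \/ B = A' ->
  prv T [] (Imp (Iff A A') (Imp (Neg (And (Neg A) B)) (Or (Neg (Neg A)) (Neg B)))) ->
  prv T [] (Imp (Iff A A') (Or (Neg A) (Neg (Neg A)))).
Proof.
  intros hB h; apply (prv_cut _ _ _ _ h), prv_impI.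
  apply (@prv_orE _ _ (Neg (Neg A)) (Neg B)).
  - apply (@prv_impE _ _ (Neg (And (Neg A) B))).
    + apply (@prv_impE _ _ (Iff A A')); hyp.
    + apply prv_impI, (@prv_impE _ _ A).
      * apply prv_andE1 with B; hyp.
      * apply (prv_cut _ _ B); [apply prv_andE2 with (Neg A); hyp | representative hB].
  - apply prv_orI2; hyp.
  - apply prv_orI1, prv_impI, (@prv_impE _ _ B); [hyp | representative hB].
Qed.

(** The De Morgan law for two [Delta] formulas assumes an equivalence for each of them. This
    lemma drops the second equivalence when both formulas are the same, and adds it when
    deriving the law from weak excluded middle for the first. *)
Lemma prv_imp_trans T E E' D :
  prv T [] (Imp E' E) -> prv T [] (Imp E D) -> prv T [] (Imp E' D).
Proof.
  intros hE; apply prv_impE, (fun h => prv_impE h hE); do 3 apply prv_impI.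
  apply (@prv_impE _ _ E); [hyp |].
  apply (@prv_impE _ _ E'); hyp.
Qed.

(** * The equivalence *)

Definition principles k Gamma : list principle :=
  [Delta_n_LEM k; Delta_DML k (neg_class Gamma); Delta_n_DML k Gamma; Delta_Delta_n_DML k].

Lemma proves_all_Delta_n_LEM k Gamma P :
  Gamma = Sigma k \/ Gamma = Pi k -> In P (principles k Gamma) ->
  proves_all P (Delta_n_LEM k).
Proof.
  intros hGamma hP I (A & A' & hA & hA' & ->).
  assert (hB : exists B, (B = A \/ B = A') /\ Gamma B)
    by (destruct hGamma as [-> | ->]; eauto).
  destruct hB as (B & hB & hGB).
  destruct hP as [<- | [<- | [<- | [<- | []]]]].
  - apply prv_instance; exists A, A'; auto.
  - apply (prv_WLEM_of_DML _ _ _ _ hB), prv_instance.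
    exists A, A', (Neg B); repeat split; auto; exists B; auto.
  - apply (prv_WLEM_of_neg_DML _ _ _ _ hB), prv_instance.
    exists A, A', B; auto.
  - apply (prv_WLEM_of_DML _ _ _ _ (or_introl eq_refl)).
    apply prv_imp_trans with (E := And (Iff A A') (Iff A A')).
    + apply prv_impI, prv_andI; hyp.
    + apply prv_instance; exists A, A', A, A'; auto.
Qed.

Lemma Delta_n_LEM_proves_all k Gamma P Q :
  proves_all P (Delta_n_LEM k) -> In Q (principles k Gamma) -> proves_all P Q.
Proof.
  intros hLEM hQ.
  assert (hW : forall A A', Sigma k A -> Pi k A' ->
    prv (HA_plus P) [] (Imp (Iff A A') (Or (Neg A) (Neg (Neg A)))))
    by (intros A A' hA hA'; apply hLEM; exists A, A'; auto).
  destruct hQ as [<- | [<- | [<- | [<- | []]]]].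
  - exact hLEM.
  - intros I (A & A' & C & hA & hA' & _ & ->).
    apply prv_DML_of_WLEM, hW; assumption.
  - intros I (A & A' & C & hA & hA' & _ & ->).
    apply prv_neg_DML_of_WLEM, hW; assumption.
  - intros I (A & A' & B & B' & hA & hA' & _ & _ & ->).
    apply prv_imp_trans with (E := Iff A A').
    + apply prv_impI, prv_andE1 with (Iff B B'); hyp.
    + apply prv_DML_of_WLEM, hW; assumption.
Qed.

Theorem proposition5p6 (k : nat) (Gamma : form -> Prop)
  (hGamma : Gamma = Sigma k \/ Gamma = Pi k) (P Q : principle)
  (hP : In P [Delta_n_LEM k; Delta_DML k (neg_class Gamma);
              Delta_n_DML k Gamma; Delta_Delta_n_DML k])
  (hQ : In Q [Delta_n_LEM k; Delta_DML k (neg_class Gamma);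
              Delta_n_DML k Gamma; Delta_Delta_n_DML k]) :
  equiv_over_HA P Q.
Proof.
  split; apply (Delta_n_LEM_proves_all k Gamma);
    eauto using proves_all_Delta_n_LEM.
Qed.
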